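(* Let $G$ be a graph and let $F:V(G)\to 2^{\mathbb Z}$ be an assignment of forbidden imbalances. Suppose that there exist an ordering $v_1,\dots,v_n$ of $V(G)$ and a spanning subgraph $H$ of $G$ such that for each vertex $v\in V(G)$, \[|F(v)|\le \deg^L_G(v)-2\deg^L_H(v)+\deg^R_H(v).\] Then $G$ has an $F$-avoiding orientation (in the imbalance sense). The same conclusion also holds when $F$ is interpreted as a set of forbidden out-degrees, i.e. there is an orientation $D$ with $\deg_D^+(v)\notin F(v)$ for all $v$.
   Context: Given an ordering $v_1,\dots,v_n$ of $V(G)$ and a subgraph $H$ of $G$ (with $H=G$ allowed), $\deg^L_H(v_i)$ is the number of edges $v_iv_j\in E(H)$ with $j<i$, and $\deg^R_H(v_i)$ is the number of edges $v_iv_j\in E(H)$ with $j>i$. For an orientation $D$ of $G$, the imbalance of $v$ is $\deg^+_D(v)-\deg^-_D(v)$ (out-degree minus in-degree), and $D$ is $F$-avoiding if $\deg^+_D(v)-\deg^-_D(v)\notin F(v)$ for every $v\in V(G)$. *)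

(* Defs.v *)
From HB Require Import structures.
From mathcomp Require Import all_boot all_order all_algebra finmap.
From mathcomp Require Import boolp classical_sets functions cardinality.

Set Implicit Arguments.
Unset Strict Implicit.
Unset Printing Implicit Defensive.

Import Order.TTheory GRing.Theory Num.Theory.

Local Open Scope ring_scope.

Record sgraph (T : finType) := SGraph {
  adj :> rel T;
  adj_sym : symmetric adj;
  adj_irr : irreflexive adj }.

(* Both graphs have vertex set T, so a subgraph in this sense is spanning. *)
Definition spanning_subgraph (T : finType) (H G : sgraph T) : Prop :=
  subrel H G.

Section Degrees.
Variables (T : finType) (n : nat) (v : 'I_n -> T) (H : sgraph T).

Definition degL (i : 'I_n) : nat := #|[set j : 'I_n | H (v i) (v j) & j < i]%N|.

Definition degR (i : 'I_n) : nat := #|[set j : 'I_n | H (v i) (v j) & i < j]%N|.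

End Degrees.

(* D x y means that the edge xy is directed from x to y. *)
Definition orientation (T : finType) (G : sgraph T) (D : rel T) : Prop :=
  subrel D G /\ (forall x y, G x y -> D x y (+) D y x).

Definition outdeg (T : finType) (D : rel T) (x : T) : nat :=
  #|[set y | D x y]|.

Definition indeg (T : finType) (D : rel T) (x : T) : nat :=
  #|[set y | D y x]|.

Definition imbalance (T : finType) (D : rel T) (x : T) : int :=
  (outdeg D x)%:Z - (indeg D x)%:Z.

Definition imbalance_avoiding (T : finType) (F : T -> set int) (D : rel T) :
    Prop :=
  forall x, ~ F x (imbalance D x).

Definition outdeg_avoiding (T : finType) (F : T -> set int) (D : rel T) :
    Prop :=
  forall x, ~ F x (outdeg D x)%:Z.

(* |A| <= k. Finiteness is explicit because fset_set is empty on infinite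
   sets; the bound k may be negative, in which case no A qualifies. *)
Definition card_le_int (A : set int) (k : int) : Prop :=
  finite_set A /\ (#|` fset_set A|%fset)%:Z <= k.

(* Main.v *)
(** Vertices are added in the given order.  Orienting the edges from a new
    vertex t to its left neighbours is a sum over subsets, and signed weights
    make it act on a product of polynomials in the out-degrees as a linear
    combination of the operators prod_{u in S} (T_t - T_u), where T_x shifts the
    out-degree of x by one and S runs over the s-subsets of the left neighbours.
    To leading order these are products of differences of derivatives.  With h
    the number of left neighbours of t in H, an inclusion-exclusion choice of the
    coefficients leaves exactly one operator of degree h away from t,
    differentiating once at each left H-neighbour of t.  So every edge of H
    raises the degree allowed at its left end by one, at the cost of lowering the
    degree allowed at t; a polynomial vanishing on F(x) at each vertex x then has
    a nonzero signed sum over the orientations. *)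

Require Import Defs.
From HB Require Import structures.
From mathcomp Require Import all_boot all_order all_algebra finmap.
From mathcomp Require Import boolp classical_sets functions cardinality.
From mathcomp Require Import ring zify fintype finset.

Set Implicit Arguments.
Unset Strict Implicit.
Unset Printing Implicit Defensive.

Import Order.TTheory GRing.Theory Num.Theory.

Local Open Scope ring_scope.

(** * Forward differences of polynomials *)

Definition diffp (p : {poly rat}) : {poly rat} := p \Po ('X + 1%:P) - p.

Lemma horner_diffp p x : (diffp p).[x] = p.[x + 1] - p.[x].
Proof. by rewrite /diffp hornerD hornerN horner_comp !hornerE. Qed.

Lemma coef_diffp p m :
  (diffp p)`_m = (\sum_(i < size p) p`_i * 'C(i, m)%:R) - p`_m.
Proof.
rewrite /diffp coefB comp_polyE coef_sum; congr (_ - _).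
apply: eq_bigr => i _; rewrite coefZ exprD1n coef_sum; congr (_ * _).
transitivity (\sum_(j < i.+1 | j == m :> nat) ('C(i, j)%:R : rat)).
  rewrite [RHS]big_mkcond; apply: eq_bigr => j _.
  by rewrite coefMn coefXn eq_sym; case: eqP => _; rewrite ?mul0rn.
have [mi|im] := leqP m i.
  by rewrite (big_pred1 (Ordinal (mi : m < i.+1)%N)).
by rewrite bin_small // big_pred0 // => j; apply/eqP; have := ltn_ord j; lia.
Qed.

(** The top coefficients cancel, and in characteristic zero the next one does not vanish. *)
Lemma size_diffp p : size (diffp p) = (size p).-1.
Proof.
case sp: (size p) => [|n].
  move/eqP: sp; rewrite size_poly_eq0 => /eqP ->.
  by rewrite /diffp comp_poly0 subr0 size_poly0.
apply/eqP; rewrite eqn_leq; apply/andP; split.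
  apply/leq_sizeP => m nm; rewrite coef_diffp sp big_ord_recr /=.
  rewrite big1 ?add0r => [|i _]; last first.
    by rewrite bin_small ?mulr0 // (leq_trans (ltn_ord i)).
  move: nm; rewrite leq_eqVlt => /predU1P[<-|nm]; first by rewrite binn mulr1 subrr.
  by rewrite bin_small // mulr0 (nth_default 0) ?sp // subr0.
case: n sp => [//|n] sp.
rewrite ltnNge; apply/negP => /leq_sizeP /(_ n (leqnn n)) /eqP; apply/negP.
(* The coefficient at [n] is [p_n + (n+1) p_(n+1) - p_n], a nonzero multiple of the leading
   coefficient. *)
rewrite coef_diffp sp !big_ord_recr /= big1 ?add0r => [|i _]; last first.
  by rewrite bin_small ?mulr0.
rewrite binn mulr1 addrAC subrr add0r binSn mulf_neq0 ?pnatr_eq0 //.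
by have := lead_coef_eq0 p; rewrite lead_coefE sp /= => ->; rewrite -size_poly_eq0 sp.
Qed.

Lemma size_iter_diffp k p : size (iter k diffp p) = (size p - k)%N.
Proof. by elim: k => [|k IH] /=; rewrite ?subn0 // size_diffp IH subnS. Qed.

(** * Signed sums over subsets *)

Section SubsetSums.
Variable T : finType.
Implicit Types (A B S Y Z U H : {set T}).

Lemma sum_subsetU1 (R : nmodType) (b : T) B (F : {set T} -> R) : b \notin B ->
  \sum_(Z : {set T} | Z \subset b |: B) F Z =
  \sum_(Z : {set T} | Z \subset B) (F Z + F (b |: Z)).
Proof.
move=> bB; rewrite (bigID (fun Z => b \in Z)) /= addrC big_split /=; congr (_ + _).
  apply: eq_bigl => Z; rewrite -subsetD1; congr (_ \subset _).
  by rewrite setU1K.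
rewrite (reindex_onto (fun Z => b |: Z) (fun Z => Z :\ b)) /=; last first.
  by move=> Z /andP[_ bZ]; rewrite setD1K.
apply: eq_bigl => Z; rewrite setU11 andbT subUset sub1set setU11 /=.
apply/andP/idP => [[sZ /eqP ZE]|sZ].
  have /negP bZ : b \notin Z by rewrite -ZE !inE eqxx.
  apply/subsetP => x xZ; have := subsetP sZ x xZ.
  by rewrite !inE => /predU1P[xb|//]; case: bZ; rewrite -xb.
split; first by rewrite (subset_trans sZ) // subsetUr.
by rewrite setU1K //; apply: contra bB; apply: (subsetP sZ).
Qed.

(** Toggling a fixed element of [B] pairs subsets of opposite sign. *)
Lemma sum_sign_subset B :
  \sum_(Z : {set T} | Z \subset B) (-1) ^+ #|Z| = (B == set0)%:R :> rat.
Proof.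
have [->|[b bB]] := set_0Vmem B.
  rewrite eqxx (big_pred1 set0) ?cards0 // => Z; exact: subset0.
rewrite (_ : B == _ = false); last by apply/eqP => B0; rewrite B0 inE in bB.
rewrite -(setD1K bB) sum_subsetU1 ?setD11 // big1 // => Z sZ.
rewrite cardsU1 (_ : b \notin Z) ?exprS ?mulN1r ?addrN //.
by apply/negP => /(subsetP sZ); rewrite setD11.
Qed.

(** Removing [Y] is a bijection onto the subsets of [B :\: Y] of size [a - #|Y|]. *)
Lemma card_between Y B a : Y \subset B -> (#|Y| <= a)%N ->
  #|[set S : {set T} | [&& Y \subset S, S \subset B & #|S| == a]]|
    = 'C(#|B| - #|Y|, a - #|Y|).
Proof.
move=> YB Ya; rewrite -cardsDS // -cards_draws.
rewrite -(card_in_imset (f := fun A => A :\: Y)); last first.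
  move=> A A'; rewrite !inE => /and3P[/setIidPr YA _ _] /and3P[/setIidPr YA' _ _] E.
  by rewrite -(setID A Y) -(setID A' Y) E YA YA'.
apply: eq_card => A; rewrite !inE; apply/imsetP/andP => [[S]|[sA /eqP cA]].
  rewrite inE => /and3P[YS SB /eqP cS] ->; split; first exact: setSD.
  by rewrite cardsDS // cS.
have AY : [disjoint A & Y].
  rewrite disjoints_subset; apply: subset_trans sA _.
  by apply/subsetP => x; rewrite !inE => /andP[].
exists (Y :|: A); last by rewrite setDUl setDv set0U; apply/esym/setDidPl.
rewrite inE subsetUl subUset YB (subset_trans sA (subsetDl _ _)) /=.
by rewrite cardsU setIC (disjoint_setI0 AY) cards0 subn0 cA addnC subnK.
Qed.

(* For a := |U| - |H| >= |H| one takes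
   c S = sum_{Z subset H - S} (-1)^|Z| / C(a - |Z|, a - |H|): the binomial is the
   number of a-sets S with Y subset S subset U - Z, so summing over S first
   leaves the alternating sum over the subsets of H - Y. *)
Lemma subset_interpolation U H : H \subset U ->
  exists c : {set T} -> rat, forall Y, Y \subset U -> #|Y| = #|H| ->
    \sum_(S : {set T} | [&& Y \subset S, S \subset U
                          & #|S| == maxn (#|U| - #|H|)%N #|H|]) c S
      = (Y == H)%:R.
Proof.
move=> HU; have [ha|ah] := leqP #|H| (#|U| - #|H|)%N; last first.
  (* Here the sets [S] have size [#|H| = #|Y|], so [Y] is the only one containing [Y]. *)
  exists (fun S => (S == H)%:R) => Y YU cY; rewrite (big_pred1 Y) // => S.
  apply/and3P/eqP => [[YS _ /eqP cS]|->]; last by rewrite subxx cY.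
  by apply/esym/eqP; rewrite eqEcard YS cS cY /=.
set a := (#|U| - #|H|)%N in ha *.
have cUE : #|U| = (a + #|H|)%N by rewrite subnK // subset_leq_card.
exists (fun S => \sum_(Z : {set T} | Z \subset H :\: S)
                   (-1) ^+ #|Z| / 'C(a - #|Z|, a - #|H|)%:R) => Y YU cY.
rewrite (exchange_big_dep (fun Z => Z \subset H :\: Y)) /=; last first.
  by move=> S Z /and3P[YS _ _] /subset_trans; apply; apply: setDS.
transitivity (\sum_(Z : {set T} | Z \subset H :\: Y) (-1) ^+ #|Z| : rat).
  apply: eq_bigr => Z ZHY.
  have /subsetDP[ZH dZY] := ZHY.
  have ZU : Z \subset U by apply: subset_trans HU.
  have cZ := subset_leq_card ZH.
  have YUZ : Y \subset U :\: Z by rewrite subsetD YU disjoint_sym.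
  have cUZ : #|U :\: Z| = (a + #|H| - #|Z|)%N by rewrite cardsDS // cUE.
  have := card_between YUZ (a := a); rewrite cY cUZ => /(_ ha) cB.
  rewrite (eq_bigl (fun S => S \in [set S : {set T} |
      [&& Y \subset S, S \subset U :\: Z & #|S| == a]])) /=; last first.
    move=> S; rewrite inE !subsetD ZH [[disjoint Z & S]]disjoint_sym.
    by do !case: (_ \subset _) => //=; rewrite ?andbF // andbC.
  rewrite sumr_const cB.
  have -> : (a + #|H| - #|Z| - #|H|)%N = (a - #|Z|)%N by lia.
  by rewrite -[LHS]mulr_natr divfK // pnatr_eq0 -lt0n bin_gt0; lia.
rewrite sum_sign_subset setD_eq0; congr (_%:R); congr (nat_of_bool _).
by rewrite eq_sym eqEcard cY leqnn andbT.
Qed.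

(* This is prod_{u in S} (T_t - T_u) = prod_{u in S} (D_t - D_u) for the shifts T
   and the differences D = T - 1; al and be are the values of a polynomial and of
   its difference, and q is the polynomial at t. *)
Lemma sum_sign_expand S (q : {poly rat}) m (al be : T -> rat) :
  \sum_(Z : {set T} | Z \subset S)
     (-1) ^+ #|Z| * q.[(m + (#|S| - #|Z|))%:R]
     * \prod_(u in S) (if u \in Z then al u + be u else al u) =
  \sum_(Y : {set T} | Y \subset S)
     (-1) ^+ #|Y| * (iter (#|S| - #|Y|) diffp q).[m%:R]
     * \prod_(u in S) (if u \in Y then be u else al u).
Proof.
elim: {S}#|S| {-2}S (erefl #|S|) q => [|n IH] S cS q.
  move/eqP: cS; rewrite cards_eq0 => /eqP ->.
  rewrite !(big_pred1 set0); try exact: subset0.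
  by rewrite !big_set0 cards0 addn0.
have [b bS] : exists b, b \in S by apply/set0Pn; rewrite -card_gt0 cS.
rewrite -(setD1K bS) in cS *; set B := S :\ b in cS *.
have bB : b \notin B by rewrite setD11.
have {}cS : #|B| = n by move: cS; rewrite cardsU1 bB => -[].
have prodE (F : T -> rat) (G : T -> rat) (Z : {set T}) :
    \prod_(u in b |: B) (if u \in Z then F u else G u) =
    (if b \in Z then F b else G b) * \prod_(u in B) (if u \in Z then F u else G u).
  by rewrite big_setU1.
have prodU (F : T -> rat) (G : T -> rat) (Z : {set T}) :
    \prod_(u in B) (if u \in b |: Z then F u else G u) =
    \prod_(u in B) (if u \in Z then F u else G u).
  apply: eq_bigr => u uB; rewrite !inE (_ : u == b = false) //.
  by apply/eqP => ub; rewrite -ub uB in bB.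
rewrite !sum_subsetU1 //.
(* Pairing [Z] with [b |: Z] turns [q(k+1) al b - q(k) (al b + be b)] into
   [(diffp q)(k) al b - q(k) be b]. The induction hypothesis then serves both [diffp q] and [q]. *)
transitivity
  (al b * \sum_(Z : {set T} | Z \subset B)
     (-1) ^+ #|Z| * (diffp q).[(m + (#|B| - #|Z|))%:R]
     * \prod_(u in B) (if u \in Z then al u + be u else al u)
   - be b * \sum_(Z : {set T} | Z \subset B)
     (-1) ^+ #|Z| * q.[(m + (#|B| - #|Z|))%:R]
     * \prod_(u in B) (if u \in Z then al u + be u else al u)).
  rewrite !mulr_sumr -sumrB; apply: eq_bigr => Z sZ.
  have bZ : b \notin Z by apply: contra bB; apply/subsetP.
  rewrite !prodE !prodU setU11 (negPf bZ) !cardsU1 bB bZ /= !add1n.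
  rewrite subSS subSn ?subset_leq_card // horner_diffp.
  rewrite addnS -natr1 exprS; ring.
rewrite !IH // !mulr_sumr -sumrB; apply: eq_bigr => Z sZ.
have bZ : b \notin Z by apply: contra bB; apply/subsetP.
rewrite !prodE !prodU setU11 (negPf bZ) !cardsU1 bB bZ /= !add1n.
rewrite subSS subSn ?subset_leq_card // iterSr exprS; ring.
Qed.

End SubsetSums.

(** * Separating signed sums and the addition of a star *)

Section Step.
Variable T : finType.

Definition orients (E D : rel T) : Prop :=
  subrel D E /\ forall x y, E x y -> D x y (+) D y x.

(* Some signed sum over the orientations of E kills the families of total degree
   less than sum_x f x, and no family of degrees exactly f. *)
Definition separating (E : rel T) (f : T -> nat) : Prop :=
  exists (I : finType) (w : I -> rat) (D : I -> rel T),
  [/\ forall i, orients E (D i),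
      forall p : T -> {poly rat},
        (\sum_x size (p x) < \sum_x (f x).+1)%N ->
        \sum_i w i * \prod_x (p x).[(outdeg (D i) x)%:R] = 0
    & forall p : T -> {poly rat},
        (forall x, size (p x) = (f x).+1) ->
        \sum_i w i * \prod_x (p x).[(outdeg (D i) x)%:R] != 0].

Definition star (t : T) (U : {set T}) : rel T :=
  fun x y => ((x == t) && (y \in U)) || ((y == t) && (x \in U)).

(* Z is the set of left neighbours u whose edge is directed from u to t. *)
Definition add_star (D : rel T) (t : T) (U Z : {set T}) : rel T :=
  fun x y => [|| D x y, (x == t) && (y \in U :\: Z) | (y == t) && (x \in U :&: Z)].

Section AddStar.
Variables (E D : rel T) (t : T) (U Z : {set T}).
Hypotheses (tU : t \notin U) (Et : forall x, E x t = false).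
Hypotheses (tE : forall x, E t x = false) (DE : orients E D).

Let Dt x : D x t = false.
Proof. by apply/negP => /DE.1; rewrite Et. Qed.
Let tD x : D t x = false.
Proof. by apply/negP => /DE.1; rewrite tE. Qed.

Lemma orients_add_star :
  orients (relU E (star t U)) (add_star D t U Z).
Proof.
split=> x y; rewrite /add_star /star /= !inE.
  case/or3P => [/DE.1 ->//|/andP[-> /andP[_ ->]]|/andP[-> /andP[-> _]]];
  by rewrite ?orbT.
have [->|xt] := eqVneq x t; have [->|yt] := eqVneq y t;
  rewrite ?(negPf tU) ?Et ?tE ?Dt ?tD //= ?orbF ?andbF //=.
- by move=> ->; rewrite andbT; case: (y \in Z).
- by move=> ->; rewrite andbT; case: (x \in Z).
- exact: DE.2.
Qed.

Lemma outdeg_add_star_center :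
  Z \subset U -> outdeg (add_star D t U Z) t = (#|U| - #|Z|)%N.
Proof.
move=> ZU; rewrite -cardsDS //; apply: eq_card => y.
by rewrite !inE /add_star tD !inE eqxx (negPf tU) /= andbF orbF.
Qed.

Lemma outdeg_add_star x : x != t -> Z \subset U ->
  outdeg (add_star D t U Z) x = (outdeg D x + (x \in Z))%N.
Proof.
move=> xt ZU; rewrite /outdeg addnC.
have -> : finset (add_star D t U Z x) =
          (if x \in Z then t |: [set y | D x y] else [set y | D x y]).
  apply/setP => y; rewrite !inE /add_star (negPf xt) !inE /=.
  case xZ: (x \in Z); rewrite !inE ?andbF ?orbF // (subsetP ZU) ?xZ //= andbT.
  by rewrite orbC.
by case: ifP; rewrite ?cardsU1 ?inE ?Dt.
Qed.

End AddStar.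

Lemma sum_mem (Y : {set T}) : (\sum_x (x \in Y) = #|Y|)%N.
Proof. by rewrite -sum1_card [RHS]big_mkcond; apply: eq_bigr => x _; case: ifP. Qed.

Lemma sum_at (t : T) k : (\sum_x (if x == t then k else 0) = k)%N.
Proof. by rewrite -big_mkcond big_pred1_eq. Qed.

Section SumAddStar.
Variables (E D : rel T) (t : T) (U : {set T}) (s : nat) (c : {set T} -> rat).
Hypotheses (tU : t \notin U) (Et : forall x, E x t = false).
Hypotheses (tE : forall x, E t x = false) (DE : orients E D).

(** What remains on the old vertices in the term of [Y]; the contribution of [t] is taken out as a
    scalar, hence the constant 1 there. *)
Definition diff_family (Y : {set T}) (p : T -> {poly rat}) (x : T) :=
  if x == t then 1 else if x \in Y then diffp (p x) else p x.

(** The operator of [S] expands into terms indexed by subsets of [S], whether in shifts or in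
    differences, so the term of [Y] collects [c S] over all [S] above [Y]. *)
Definition up_sum (Y : {set T}) : rat :=
  \sum_(S : {set T} | [&& Y \subset S, S \subset U & #|S| == s]) c S.

(** Regrouped by [S], both sides are combinations with coefficients [c S] of the two sides of
    [sum_sign_expand]. *)
Lemma sum_add_star (p : T -> {poly rat}) :
  \sum_(Z : {set T}) (-1) ^+ #|Z| * up_sum Z
     * \prod_x (p x).[(outdeg (add_star D t U Z) x)%:R] =
  \sum_(Y : {set T} | Y \subset U)
     (-1) ^+ #|Y| * (iter (s - #|Y|) diffp (p t)).[(#|U| - s)%:R] * up_sum Y
     * \prod_x (diff_family Y p x).[(outdeg D x)%:R].
Proof.
pose al x := (p x).[(outdeg D x)%:R].
pose be x := (diffp (p x)).[(outdeg D x)%:R].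
have prodE (S : {set T}) (F : T -> rat) : S \subset U ->
    \prod_x F x = F t * (\prod_(x in S) F x * \prod_(x | (x != t) && (x \notin S)) F x).
  move=> SU; rewrite (bigD1 t) //= (bigID (fun x => x \in S)) /=.
  congr (_ * (_ * _)); apply: eq_bigl => x.
  apply/andP/idP => [[]//|xS]; split=> //; apply: contraNneq tU => <-.
  exact: (subsetP SU).
transitivity (\sum_(S : {set T} | (S \subset U) && (#|S| == s)) c S *
    \sum_(Z : {set T} | Z \subset S)
      (-1) ^+ #|Z| * \prod_x (p x).[(outdeg (add_star D t U Z) x)%:R]).
  under [RHS]eq_bigr do rewrite mulr_sumr.
  rewrite [RHS](exchange_big_dep predT) //=; apply: eq_bigr => Z _.
  rewrite /up_sum mulr_sumr mulr_suml; apply: eq_big => [S|S _].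
    by rewrite andbC.
  ring.
transitivity (\sum_(S : {set T} | (S \subset U) && (#|S| == s)) c S *
    \sum_(Y : {set T} | Y \subset S)
      (-1) ^+ #|Y| * (iter (s - #|Y|) diffp (p t)).[(#|U| - s)%:R]
      * \prod_x (diff_family Y p x).[(outdeg D x)%:R]); last first.
  under eq_bigr do rewrite mulr_sumr.
  rewrite (exchange_big_dep (fun Y : {set T} => Y \subset U)) /=; last first.
    by move=> S Y /andP[SU _] /subset_trans; apply.
  apply: eq_bigr => Y YU.
  rewrite /up_sum mulr_sumr mulr_suml; apply: eq_big => [S|S _].
    by rewrite andbC.
  ring.
apply: eq_bigr => S /andP[SU /eqP cS]; congr (_ * _).
have sU : (s <= #|U|)%N by rewrite -cS subset_leq_card.
(* For [Z] inside [S] these vertices keep their out-degree, so [R] is a common factor; at [t] the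
   out-degree splits as [(#|U| - s) + (s - #|Z|)]. *)
pose R := \prod_(x | (x != t) && (x \notin S)) al x.
transitivity ((\sum_(Z : {set T} | Z \subset S)
     (-1) ^+ #|Z| * (p t).[(#|U| - s + (#|S| - #|Z|))%:R]
     * \prod_(u in S) (if u \in Z then al u + be u else al u)) * R).
  rewrite mulr_suml; apply: eq_bigr => Z ZS.
  have ZU := subset_trans ZS SU; have cZ := subset_leq_card ZS.
  rewrite (prodE S) // (outdeg_add_star_center tU tE DE ZU) -!mulrA.
  congr (_ * _); congr (_ * _).
    by congr (_.[_%:R]); rewrite cS in cZ *; lia.
  congr (_ * _); apply: eq_bigr => x.
    move=> xS; have xt : x != t.
      by apply: contraNneq tU => <-; apply: (subsetP SU).
    rewrite (outdeg_add_star Et DE xt ZU) /al /be.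
    case: (x \in Z); last by rewrite addn0.
    by rewrite horner_diffp addn1 -natr1 [RHS]addrC subrK.
  case/andP=> xt xS; rewrite (outdeg_add_star Et DE xt ZU).
  have xZ : x \in Z = false by apply: contraNF xS; apply: (subsetP ZS).
  by rewrite xZ addn0.
rewrite sum_sign_expand mulr_suml; apply: eq_bigr => Y YS.
rewrite (prodE S) // {1}/diff_family eqxx hornerC mul1r cS -!mulrA.
congr (_ * (_ * _)); congr (_ * _); apply: eq_bigr => x.
  move=> xS; rewrite /diff_family (_ : x == t = false); first by case: ifP.
  by apply: contraNF tU => /eqP <-; apply: (subsetP SU).
case/andP=> xt xS; rewrite /diff_family (negPf xt).
have -> // : x \in Y = false by apply: contraNF xS; apply: (subsetP YS).
Qed.

End SumAddStar.

(* The sets have size s = max(|U| - |H|, |H|).  For p of the maximal degrees, the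
   term of Y vanishes by degree at t if |Y| < |H|, by the total degree at the
   other vertices if |Y| > |H|, and by the choice of the coefficients if
   |Y| = |H| and Y <> H. *)
Lemma separating_add_star (E : rel T) (f : T -> nat) (t : T) (U H : {set T}) :
  t \notin U -> H \subset U ->
  (forall x, E x t = false) -> (forall x, E t x = false) -> f t = 0%N ->
  separating E f ->
  separating (relU E (star t U))
    (fun x => f x + (x \in H) + if x == t then #|U| - #|H| - #|H| else 0)%N.
Proof.
move=> tU HU Et tE ft0 [I [w [D [oD vD nD]]]].
have [c cE] := subset_interpolation HU.
set s := maxn _ _ in cE.
have hs : (#|H| <= s)%N by rewrite leq_maxr.
have sh : (#|U| - #|H| - #|H| = s - #|H|)%N by rewrite /s; lia.
pose A (Y : {set T}) p := (iter (s - #|Y|) diffp (p t)).[(#|U| - s)%:R].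
have key (p : T -> {poly rat}) :
    \sum_(k : I * {set T}) w k.1 * ((-1) ^+ #|k.2| * up_sum U s c k.2)
      * \prod_x (p x).[(outdeg (add_star (D k.1) t U k.2) x)%:R] =
    \sum_(Y : {set T} | Y \subset U) (-1) ^+ #|Y| * A Y p * up_sum U s c Y
      * \sum_i w i * \prod_x (diff_family t Y p x).[(outdeg (D i) x)%:R].
  rewrite -(pair_bigA _ (fun i (Z : {set T}) => w i * ((-1) ^+ #|Z| * up_sum U s c Z)
      * \prod_x (p x).[(outdeg (add_star (D i) t U Z) x)%:R])) /=.
  under [RHS]eq_bigr do rewrite mulr_sumr.
  rewrite [RHS]exchange_big /=; apply: eq_bigr => i _.
  under eq_bigr do rewrite -mulrA.
  rewrite -mulr_sumr (sum_add_star _ _ tU Et tE (oD i)) mulr_sumr.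
  apply: eq_bigr => Y _; rewrite /A; ring.
(* The polynomial at [t] is replaced by one of size 1, and each vertex of [Y] loses one degree. *)
have size_sum (Y : {set T}) (p : T -> {poly rat}) : Y \subset U ->
    (forall x, p x != 0) ->
    (\sum_x size (diff_family t Y p x) + #|Y| + size (p t)
      = (\sum_x size (p x)).+1)%N.
  move=> YU p0; rewrite -addn1 -(sum_mem Y) -{1}(sum_at t (size (p t))).
  rewrite -[in RHS](sum_at t 1) -!big_split /=; apply: eq_bigr => x _.
  rewrite /diff_family; have [->|_] := eqVneq x t.
    have -> : t \in Y = false by apply: contraNF tU; apply: (subsetP YU).
    by rewrite size_poly1 addn0 addnC.
  case: (x \in Y); rewrite !addn0 // size_diffp addn1 prednK //.
  by rewrite lt0n size_poly_eq0.
have A0 (Y : {set T}) (p : T -> {poly rat}) : (size (p t) <= s - #|Y|)%N -> A Y p = 0.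
  rewrite -subn_eq0 -size_iter_diffp size_poly_eq0 /A => /eqP ->.
  by rewrite horner0.
have sum_f : (\sum_x (f x + (x \in H) + if x == t then #|U| - #|H| - #|H| else 0).+1
              = \sum_x (f x).+1 + s)%N.
  set k := (_ - _ - _)%N in sh *; rewrite -(subnKC hs) -sh.
  rewrite -[X in (_ + (X + _))%N]sum_mem -[X in (_ + (_ + X))%N](sum_at t).
  by rewrite -!big_split; apply: eq_bigr => x _ /=; rewrite addSn addnA.
exists (I * {set T})%type, (fun k : I * {set T} => w k.1 * ((-1) ^+ #|k.2| * up_sum U s c k.2)).
exists (fun k : I * {set T} => add_star (D k.1) t U k.2); split.
- by move=> k; apply: orients_add_star.
- move=> p; rewrite sum_f => lt_p.
  (* A zero polynomial has size 0, which breaks the size count, but it makes every product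
     vanish. *)
  have [p0|/forallPn[x /negPn/eqP px0]] := boolP [forall x, p x != 0]; last first.
    rewrite big1 // => k _; apply/eqP; rewrite mulf_eq0; apply/orP; right.
    by rewrite (bigD1 x) //= px0 horner0 mul0r.
  rewrite key big1 // => Y YU.
  have := size_sum Y p YU (forallP p0).
  (* Either the differences at [t] kill [p t], or [#|Y| + size (p t)] exceeds [s] and the remaining
     family falls below the old total. *)
  have [/A0 -> _|lt_s sE] := leqP (size (p t)) (s - #|Y|)%N.
    by rewrite mulr0 !mul0r.
  by rewrite vD ?mulr0 //; lia.
- move=> p size_p.
  have p0 x : p x != 0 by rewrite -size_poly_eq0 size_p.
  have spt : size (p t) = (s - #|H|).+1.
    have tH : t \in H = false by apply: contraNF tU; apply: (subsetP HU).
    by rewrite size_p ft0 eqxx -sh tH.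
  rewrite key (bigD1 H) //= [X in _ + X]big1 ?addr0.
    rewrite /up_sum cE // eqxx mulr1 !mulf_neq0 ?signr_eq0 //.
      rewrite /A; have : size (iter (s - #|H|) diffp (p t)) == 1.
        by rewrite size_iter_diffp spt subSnn.
      by case/size_poly1P => k k0 ->; rewrite hornerC.
    apply: nD => x; rewrite /diff_family.
    have [->|xt] := eqVneq x t; first by rewrite size_poly1 ft0.
    have := size_p x; rewrite (negPf xt) addn0.
    by case: (x \in H) => sp; rewrite ?size_diffp sp ?addn1 ?addn0.
  move=> Y /andP[YU YH].
  have [ltY|gtY|eqY] := ltngtP #|Y| #|H|.
  + by rewrite A0 ?mulr0 ?mul0r // spt; lia.
  + have := size_sum Y p YU p0; rewrite (eq_bigr _ (fun x _ => size_p x)) sum_f spt => sE.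
    by rewrite vD ?mulr0 //; lia.
  + by rewrite /up_sum cE // (negPf YH) mulr0 mul0r.
Qed.

(** * The edgeless case and the extraction of an orientation *)

Lemma eq_separating (E E' : rel T) (f f' : T -> nat) :
  E =2 E' -> f =1 f' -> separating E f -> separating E' f'.
Proof.
move=> EE' /funext <-; suff -> : E' = E by [].
by apply/funext => x; apply/funext => y.
Qed.

(** A total size below [#|T|] forces some zero polynomial, while polynomials of size 1 are nonzero
    constants. *)
Lemma separating_empty : separating (fun _ _ : T => false) (fun=> 0%N).
Proof.
have od x : outdeg (fun _ _ : T => false) x = 0%N.
  by apply: eq_card0 => y; rewrite !inE.
exists unit, (fun=> 1), (fun _ _ _ => false); split=> // p size_p.
- have [p0|/forallPn[x /negPn/eqP px0]] := boolP [forall x, p x != 0].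
    have : (\sum_(x : T) 1 <= \sum_x size (p x))%N.
      by apply: leq_sum => x _; rewrite lt0n size_poly_eq0 (forallP p0).
    by rewrite leqNgt size_p.
  by rewrite big1 // => i _; rewrite (bigD1 x) //= px0 horner0 mul0r mulr0.
- rewrite (big_pred1 tt) ?mul1r; last by case.
  apply/prodf_neq0 => x _; have /eqP/size_poly1P[k k0 ->] := size_p x.
  by rewrite hornerC.
Qed.

(** As in the Combinatorial Nullstellensatz: polynomials vanishing on the lists have a nonzero
    signed sum, and any nonzero term is an avoiding orientation. *)
Lemma separating_avoid (E : rel T) (f : T -> nat) (L : T -> seq rat) :
  separating E f -> (forall x, (size (L x) <= f x)%N) ->
  exists D : rel T, orients E D /\ forall x, (outdeg D x)%:R \notin L x.
Proof.
move=> [I [w [D [oD _ nD]]]] Lf.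
(* Padding with roots 0 makes the degree exactly [f x]; extra roots only forbid more. *)
pose L' x := L x ++ nseq (f x - size (L x)) 0.
pose p x := \prod_(a <- L' x) ('X - a%:P).
have size_p x : size (p x) = (f x).+1.
  by rewrite size_prod_XsubC size_cat size_nseq subnKC.
have [i pi] : exists i, \prod_x (p x).[(outdeg (D i) x)%:R] != 0.
  apply/existsP; apply: contra_neqT (nD p size_p) => /existsPn p0.
  by rewrite big1 // => i _; have /negPn/eqP -> := p0 i; rewrite mulr0.
exists (D i); split=> // x; apply/negP => xL.
move/prodf_neq0: pi => /(_ x isT); rewrite -[_ == 0]/(root _ _).
by rewrite root_prod_XsubC mem_cat xL.
Qed.

(** * Induction along the vertex ordering *)

Section Ordering.
Variables (n : nat) (v : 'I_n -> T) (r : T -> 'I_n).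
Hypotheses (vK : cancel v r) (rK : cancel r v).
Variables (G H : sgraph T).
Hypothesis HG : spanning_subgraph H G.

Definition left_nbrs (K : rel T) (x : T) := [set y | K x y & (r y < r x)%N].

(* Subtraction is truncated, so this may exceed deg^L_G - 2 deg^L_H. *)
Definition surplus (x : T) : nat :=
  #|left_nbrs G x| - #|left_nbrs H x| - #|left_nbrs H x|.

(** Each step adds the star from the vertex of rank [k] to its left neighbours. A placed vertex is
    credited with its right H-neighbours placed so far, an unplaced one with 0. *)
Lemma separating_prefix k : (k <= n)%N ->
  separating (fun x y => [&& G x y, (r x < k)%N & (r y < k)%N])
    (fun x => #|[set y | H x y & (r x < r y < k)%N]|
              + if (r x < k)%N then surplus x else 0)%N.
Proof.
elim: k => [_|k IH kn].
  apply: eq_separating separating_empty => [x y|x].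
    by rewrite andbF.
  by rewrite addn0; apply/esym/eq_card0 => y; rewrite !inE ltn0 !andbF.
pose t := v (Ordinal kn).
have rt : r t = k :> nat by rewrite /t vK.
have eqt x : (x == t) = (r x == k :> nat).
  by rewrite -rt (inj_eq val_inj) (can_eq rK).
have lnE (K : rel T) : left_nbrs K t = [set y | K t y & (r y < k)%N].
  by rewrite /left_nbrs rt.
have tU : t \notin left_nbrs G t by rewrite inE ltnn andbF.
have HU : left_nbrs H t \subset left_nbrs G t.
  by apply/subsetP => x; rewrite !inE => /andP[/HG -> ->].
have ltt : (r t < k)%N = false by rewrite rt ltnn.
have c0 : #|[set y | H t y & (r t < r y < k)%N]| = 0%N.
  by apply: eq_card0 => y; rewrite !inE rt; case: ltngtP; rewrite ?andbF.
have Et x : [&& G x t, (r x < k)%N & (r t < k)%N] = false by rewrite ltt !andbF.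
have tE x : [&& G t x, (r t < k)%N & (r x < k)%N] = false by rewrite ltt andbF.
have := separating_add_star tU HU Et tE _ (IH (ltnW kn)).
rewrite ltt c0 => /(_ erefl); apply: eq_separating => x.
- move=> y; rewrite /star /= !lnE !inE !eqt !ltnS.
  rewrite (leq_eqVlt (r x)) (leq_eqVlt (r y)).
  have [rx|rx] := eqVneq (r x : nat) k; have [ry|ry] := eqVneq (r y : nat) k;
    rewrite /= ?rx ?ry ?ltnn ?andbF ?andbT ?orbF //=.
  + have -> : x = y by apply/(can_inj rK)/val_inj; rewrite /= rx ry.
    by rewrite adj_irr.
  + by move/eqP: rx; rewrite -eqt => /eqP ->.
  + by move/eqP: ry; rewrite -eqt => /eqP ->; rewrite adj_sym.
- rewrite ltnS (leq_eqVlt (r x)) eqt.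
  have [rx|rx] := eqVneq (r x : nat) k => /=.
    have /eqP -> : x == t by rewrite eqt rx.
    rewrite ltt c0 inE ltnn andbF ?rt ?leqnn [#|_| in RHS]eq_card0 // => y.
    by rewrite !inE ltnS; case: ltngtP; rewrite ?andbF.
  rewrite addn0 addnAC; congr (_ + _)%N; rewrite lnE inE.
  (* The right H-neighbours of an earlier [x] gain [t] exactly when [x] is a left H-neighbour of
     [t]. *)
  rewrite (cardsD1 t [set y | H x y & (r x < r y < k.+1)%N]) addnC !inE rt ltnSn andbT.
  rewrite adj_sym; congr (_ + _)%N; apply: eq_card => y; rewrite !inE ltnS eqt.
  by rewrite [(r y <= k)%N]leq_eqVlt; case: eqVneq => [->|]; rewrite ?ltnn ?andbF.
Qed.

Lemma card_left_nbrs (K : sgraph T) x : #|left_nbrs K x| = degL v K (r x).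
Proof.
rewrite /degL -(card_imset _ (can_inj vK)); apply: eq_card => y.
rewrite inE; apply/idP/imsetP => [|[j]].
  by move=> yK; exists (r y); rewrite ?rK // inE !rK.
by rewrite inE rK => /andP[xj jx] ->; rewrite xj vK.
Qed.

Lemma card_right_nbrs (K : sgraph T) x :
  #|[set y | K x y & (r x < r y < n)%N]| = degR v K (r x).
Proof.
rewrite /degR -(card_imset _ (can_inj vK)); apply: eq_card => y.
rewrite inE ltn_ord andbT; apply/idP/imsetP => [|[j]].
  by move=> yK; exists (r y); rewrite ?rK // inE !rK.
by rewrite inE rK => /andP[xj jx] ->; rewrite xj vK.
Qed.

Lemma orientation_avoiding (L : T -> seq rat) :
  (forall x, (size (L x) <=
     degR v H (r x) + (degL v G (r x) - degL v H (r x) - degL v H (r x)))%N) ->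
  exists D : rel T, orientation G D /\ forall x, (outdeg D x)%:R \notin L x.
Proof.
move=> Lf; have sep := separating_prefix (leqnn n).
have [|D [oD aD]] := separating_avoid (L := L) sep.
  by move=> x; rewrite ltn_ord card_right_nbrs /surplus !card_left_nbrs.
exists D; split=> //; case: oD => sD tD; split.
  by move=> x y /sD /and3P[].
by move=> x y xy; apply: tD; rewrite xy !ltn_ord.
Qed.

End Ordering.

Lemma card_orientation (G : sgraph T) (D : rel T) x : orientation G D ->
  (outdeg D x + indeg D x = #|[set y | G x y]|)%N.
Proof.
move=> [sD tD]; rewrite /outdeg /indeg -cardsUI.
rewrite [X in (_ + X)%N]eq_card0 ?addn0 => [|y].
  apply: eq_card => y; rewrite !inE; apply/orP/idP => [[/sD//|/sD]|/tD].
    by rewrite adj_sym.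
  by case: (D x y); [left|right].
rewrite !inE; apply/negP => /andP[xy yx].
by have := tD x y (sD _ _ xy); rewrite xy yx.
Qed.

End Step.

(** * From forbidden imbalances to forbidden out-degrees *)

Theorem theorem6 (T : finType) (G : sgraph T) (F : T -> set int)
    (n : nat) (v : 'I_n -> T) (v_bij : bijective v)
    (H : sgraph T) (HG : spanning_subgraph H G)
    (F_small : forall i : 'I_n,
       card_le_int (F (v i))
         ((degL v G i)%:Z - 2 * (degL v H i)%:Z + (degR v H i)%:Z)) :
  (exists D : rel T, orientation G D /\ imbalance_avoiding F D) /\
  (exists D : rel T, orientation G D /\ outdeg_avoiding F D).
Proof.
case: v_bij => r vK rK.
pose Fs x : seq int := fset_set (F x).
have memFs x z : F x z -> z \in Fs x.
  have [finF _] := F_small (r x); rewrite rK in finF.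
  by move=> Fz; rewrite in_fset_set //; apply: mem_set.
have sizeFs x : (size (Fs x) <=
    degR v H (r x) + (degL v G (r x) - degL v H (r x) - degL v H (r x)))%N.
  by have [_] := F_small (r x); rewrite rK -[#|` _|%fset]/(size (Fs x)); lia.
split.
  (* Out-degree and in-degree add up to the degree, so imbalance [z] means out-degree
     [(z + deg) / 2]. Over the rationals a [z] of the wrong parity gives a harmless non-integral
     entry. *)
  pose L x := [seq (z%:~R + #|[set y | G x y]|%:R) / 2 : rat | z <- Fs x].
  have [|D [oD aD]] := orientation_avoiding vK rK HG (L := L).
    by move=> x; rewrite size_map.
  exists D; split=> // x Fx; have /negP := aD x; apply; apply/mapP.
  exists (imbalance D x); first exact: memFs.
  rewrite -(card_orientation x oD) /imbalance natrD rmorphB /=.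
  by field.
pose L x := [seq z%:~R : rat | z <- Fs x].
have [|D [oD aD]] := orientation_avoiding vK rK HG (L := L).
  by move=> x; rewrite size_map.
exists D; split=> // x Fx; have /negP := aD x; apply; apply/mapP.
by exists (outdeg D x)%:Z; first exact: memFs.
Qed.
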